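(* Let $E$ be a symmetric space on $I=[0,1]$ and let $M(E)$ be its multiplicator with respect to tensor product. Then the fundamental function $\phi_{M(E)}(t)=\|\chi_{(0,t)}\|_{M(E)}$ satisfies $$\phi_{M(E)}(t)=\|\sigma_t\|_{E\to E}\qquad (0<t\le 1).$$
   Context: $I=[0,1]$ with Lebesgue measure $\mu$. For a measurable function $z$ on $I$ or $I\times I$, $n_z(\tau)=\mu\{w:|z(w)|>\tau\}$ ($\tau>0$) is the distribution function of $|z|$ (on $I\times I$, $\mu$ is two-dimensional Lebesgue measure); two functions are equimeasurable if their distribution functions coincide; $z^*$ is the left-continuous non-increasing rearrangement of $|z|$ on $(0,1]$. A symmetric space on $I$ is a nonzero Banach space $E$ of (classes of) measurable functions on $I$ such that: (a) $y\in E$ and $|x|\le|y|$ a.e. imply $x\in E$ and $\|x\|_E\le\|y\|_E$; (b) $y\in E$ and $x$ equimeasurable with $y$ imply $x\in E$ and $\|x\|_E=\|y\|_E$. $E(I\times I)$ denotes the space of measurable $z$ on $I\times I$ with $z^*\in E$, normed by $\|z\|_{E(I\times I)}=\|z^*\|_E$. For measurable $x,y$ on $I$, $(x\otimes y)(s,t)=x(s)y(t)$. The multiplicator $M(E)$ is the set of all measurable $x$ on $I$ such that $x\otimes y\in E(I\times I)$ for every $y\in E$, with norm $\|x\|_{M(E)}=\sup\{\|x\otimes y\|_{E(I\times I)}:\|y\|_E\le1\}$; it is a symmetric space on $I$. For $t>0$ the dilation operator is $\sigma_t y(u)=y(u/t)\chi_{[0,1]}(u/t)$, $u\in I$. *)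

(* Defs.v *)
From HB Require Import structures.
From mathcomp Require Import all_boot all_order all_algebra.
From mathcomp Require Import all_classical all_reals all_analysis.

Set Implicit Arguments.
Unset Strict Implicit.
Unset Printing Implicit Defensive.

Import Order.TTheory GRing.Theory Num.Theory.
Import numFieldNormedType.Exports.

Local Open Scope classical_set_scope.
Local Open Scope ring_scope.

(* Functions on I (resp. I x I) are represented by total functions on R        *)
(* (resp. R * R) of which only the values on I (resp. I x I) matter, and       *)
(* classes by representatives. Measurability is with respect to the Borel      *)
(* sigma-algebra: every Lebesgue measurable function is a.e. equal to a Borel  *)
(* one, so the spaces of classes modulo a.e. equality are the same.            *)

Definition unitI (R : realType) : set R := `[0, 1].
Arguments unitI : clear implicits.

Definition unitII (R : realType) : set (R * R) := unitI R `*` unitI R.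
Arguments unitII : clear implicits.

Definition leb2 (R : realType) : set (R * R) -> \bar R :=
  (@lebesgue_measure R \x @lebesgue_measure R)%E.

Definition distrf (R : realType) (T : Type) (mu : set T -> \bar R) (D : set T)
    (z : T -> R) (tau : R) : \bar R :=
  mu (D `&` [set w | tau < `|z w|]).

Definition equimeasurable (R : realType) (x y : R -> R) : Prop :=
  forall tau : R, 0 < tau ->
    distrf (@lebesgue_measure R) (unitI R) x tau =
    distrf (@lebesgue_measure R) (unitI R) y tau.

(* The strict inequality makes the rearrangement left-continuous on (0, 1].    *)
Definition rearr (R : realType) (T : Type) (mu : set T -> \bar R) (D : set T)
    (z : T -> R) (u : R) : R :=
  inf [set tau : R | 0 < tau /\ (distrf mu D z tau < u%:E)%E].

(* [ss_norm] is only meaningful on [ss_car]. Invariance of both under a.e.     *)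
(* equality on I follows from [ss_ideal].                                      *)
Record symmetric_space (R : realType) := SymmetricSpace {
  ss_car : set (R -> R) ;
  ss_norm : (R -> R) -> R ;
  ss_meas : forall x, ss_car x -> measurable_fun (unitI R) x ;
  ss_add : forall x y, ss_car x -> ss_car y -> ss_car (fun s => x s + y s) ;
  ss_scale : forall (a : R) x, ss_car x -> ss_car (fun s => a * x s) ;
  ss_normD : forall x y, ss_car x -> ss_car y ->
    ss_norm (fun s => x s + y s) <= ss_norm x + ss_norm y ;
  ss_normZ : forall (a : R) x, ss_car x ->
    ss_norm (fun s => a * x s) = `|a| * ss_norm x ;
  ss_norm0_ae : forall x, ss_car x -> ss_norm x = 0 ->
    {ae @lebesgue_measure R, forall s, unitI R s -> x s = 0} ;
  ss_complete : forall x_ : nat -> R -> R,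
    (forall n, ss_car (x_ n)) ->
    (forall e : R, 0 < e -> exists N : nat, forall m n : nat,
       (N <= m)%N -> (N <= n)%N -> ss_norm (fun s => x_ m s - x_ n s) < e) ->
    exists x, ss_car x /\
      (fun n => ss_norm (fun s => x_ n s - x s)) @ \oo --> (0 : R) ;
  ss_nonzero : exists x, ss_car x /\
    ~ {ae @lebesgue_measure R, forall s, unitI R s -> x s = 0} ;
  ss_ideal : forall x y : R -> R, measurable_fun (unitI R) x -> ss_car y ->
    {ae @lebesgue_measure R, forall s, unitI R s -> `|x s| <= `|y s|} ->
    ss_car x /\ ss_norm x <= ss_norm y ;
  ss_symm : forall x y : R -> R, measurable_fun (unitI R) x -> ss_car y ->
    equimeasurable x y ->
    ss_car x /\ ss_norm x = ss_norm y
}.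

Definition ss2_car (R : realType) (E : symmetric_space R) : set (R * R -> R) :=
  [set z | measurable_fun (unitII R) z /\
           ss_car E (rearr (@leb2 R) (unitII R) z)].

Definition ss2_norm (R : realType) (E : symmetric_space R) (z : R * R -> R) : R :=
  ss_norm E (rearr (@leb2 R) (unitII R) z).

Definition tensorf (R : realType) (x y : R -> R) : R * R -> R :=
  fun p => x p.1 * y p.2.

Definition mult_car (R : realType) (E : symmetric_space R) : set (R -> R) :=
  [set x | measurable_fun (unitI R) x /\
           forall y, ss_car E y -> ss2_car E (tensorf x y)].

Definition ss_ball (R : realType) (E : symmetric_space R) : set (R -> R) :=
  [set y | ss_car E y /\ ss_norm E y <= 1].

(* Suprema are taken in the extended reals, so that no default value hides an  *)
(* unbounded set.                                                              *)
Definition mult_norm (R : realType) (E : symmetric_space R) (x : R -> R) : \bar R :=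
  ereal_sup [set (ss2_norm E (tensorf x y))%:E | y in ss_ball E].

Definition mult_fundamental (R : realType) (E : symmetric_space R) (t : R) : \bar R :=
  mult_norm E (\1_(`]0, t[ : set R)).

Definition dilation (R : realType) (t : R) (y : R -> R) : R -> R :=
  fun u => y (u / t) * \1_(unitI R) (u / t).

(* Only meaningful when [T] maps [ss_car E] into itself.                       *)
Definition ss_opnorm (R : realType) (E : symmetric_space R)
    (T : (R -> R) -> R -> R) : \bar R :=
  ereal_sup [set (ss_norm E (T y))%:E | y in ss_ball E].

(* Main.v *)
Require Import Defs.
From mathcomp Require Import all_boot all_order all_algebra.
From mathcomp Require Import all_classical all_reals all_analysis.
From mathcomp Require Import measurable_realfun.

Import Order.TTheory GRing.Theory Num.Theory.
Import numFieldNormedType.Exports.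

Local Open Scope classical_set_scope.
Local Open Scope ring_scope.

(** Both [1_(0,t) (x) y] on [I x I] and the dilation of [y] on [I] have
    distribution function [t n_y], where [n_y] is that of [y]. Since a function
    is equimeasurable with its rearrangement, the two have the same [E]-norm,
    and the two suprema run over the same numbers. These are at most [1] on the
    unit ball, because [t n_y <= n_y] and an inequality of distribution
    functions gives an inequality of norms. *)

(** * Distribution functions and rearrangements over a set of measure at most one *)

Section rearrangement.
Context {d : measure_display} {R : realType} {T : measurableType d}.
Variables (mu : {measure set T -> \bar R}) (D : set T) (z : T -> R).
Hypotheses (mD : measurable D) (mz : measurable_fun D z).
Hypothesis muD : (mu D <= 1)%E.

Let n := distrf mu D z.

Lemma measurable_superlevel tau : measurable (D `&` [set w | tau < `|z w|]).
Proof.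
have mnz : measurable_fun D (Num.norm \o z).
  by apply: (measurableT_comp _ mz); exact: normr_measurable.
rewrite (_ : [set w | tau < `|z w|] = (Num.norm \o z) @^-1` `]tau, +oo[).
  exact: mnz.
by apply/seteqP; split => w /=; rewrite in_itv/= andbT.
Qed.

Lemma distrf_ge0 tau : (0 <= n tau)%E.
Proof. exact: measure_ge0. Qed.

Lemma distrf_le1 tau : (n tau <= 1)%E.
Proof.
apply: le_trans muD; apply: le_measure; rewrite ?inE//.
exact: measurable_superlevel.
Qed.

Lemma distrf_fin_num tau : n tau \is a fin_num.
Proof.
by rewrite ge0_fin_numE ?distrf_ge0// (le_lt_trans (distrf_le1 tau))// ltry.
Qed.

Lemma distrf_nonincreasing (a b : R) : a <= b -> (n b <= n a)%E.
Proof.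
move=> ab; apply: le_measure; rewrite ?inE; try exact: measurable_superlevel.
by move=> w [Dw /= zw]; split => //=; exact: le_lt_trans zw.
Qed.

(** Right-continuity of [n]: the superlevel sets at [tau + 1/(k+1)] increase to the one at [tau],
    and [mu] is continuous from below. *)
Lemma distrf_gt_right (u tau : R) : (u%:E < n tau)%E ->
  exists2 tau', tau < tau' & (u%:E < n tau')%E.
Proof.
move=> un.
pose F k := D `&` [set w | tau + k.+1%:R^-1 < `|z w|].
have FE : \bigcup_k F k = D `&` [set w | tau < `|z w|].
  apply/seteqP; split => [w [k _ [Dw /= zw]]|w [Dw /= zw]].
    by split => //=; apply: lt_trans zw; rewrite ltrDl.
  have zt : 0 < `|z w| - tau by rewrite subr_gt0.
  have [k _ /(_ k (leqnn k)) kz] := near_infty_natSinv_lt (PosNum zt).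
  by exists k => //; split => //=; rewrite -ltrBrDl.
have cF : (mu \o F) k @[k --> \oo] --> n tau.
  rewrite /n /distrf -FE; apply: nondecreasing_cvg_mu.
  - by move=> k; exact: measurable_superlevel.
  - by rewrite FE; exact: measurable_superlevel.
  - move=> i j ij; apply/subsetPset => w [Dw /= zw]; split => //=.
    apply: le_lt_trans zw; rewrite lerD2l lef_pV2 ?posrE//.
    by rewrite ler_nat ltnS.
have [k _ /(_ k (leqnn k)) uk] := cF _ (open_ereal_gt_ereal un).
by exists (tau + k.+1%:R^-1) => //; rewrite ltrDl.
Qed.

(** As [z] is finite everywhere, its superlevel sets at [k+1] decrease to the empty set, and [mu D]
    is finite. Hence for [u > 0] the infimum defining [rearr] is over a nonempty set. *)
Lemma distrf_lt_infty (u : R) : 0 < u -> exists2 tau, 0 < tau & (n tau < u%:E)%E.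
Proof.
move=> u0.
pose F k := D `&` [set w | k.+1%:R < `|z w|].
have FE : \bigcap_k F k = set0.
  apply/seteqP; split => // w Fw.
  (* At [k] the integer part of [|z w|], the level [k+1] already exceeds [|z w|]. *)
  have [_ /=] := Fw (Num.trunc `|z w|) I.
  by rewrite ltNge (ltW (truncnS_gt _)).
have cF : (mu \o F) k @[k --> \oo] --> (0 : \bar R)%E.
  rewrite -(measure0 mu) -FE; apply: nonincreasing_cvg_mu.
  - by rewrite (le_lt_trans (distrf_le1 _))// ltry.
  - by move=> k; exact: measurable_superlevel.
  - by rewrite FE.
  - move=> i j ij; apply/subsetPset => w [Dw /= zw]; split => //=.
    by apply: le_lt_trans zw; rewrite ler_nat ltnS.
have u0' : (0 < u%:E)%E by rewrite lte_fin.
have [k _ /(_ k (leqnn k)) uk] := cF _ (open_ereal_lt_ereal u0').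
by exists k.+1%:R.
Qed.

Let rz := rearr mu D z.

Lemma rearr_ge0 u : 0 <= rz u.
Proof.
rewrite /rz /rearr; set S := [set _ | _].
have [->|/set0P S0] := eqVneq S set0; first by rewrite inf0.
by apply: lb_le_inf => // x [/ltW].
Qed.

(** No level satisfies [n tau < u], and the infimum of the empty set is [0] by convention. *)
Lemma rearr_le0 u : u <= 0 -> rz u = 0.
Proof.
move=> u0; rewrite /rz /rearr (_ : [set _ | _] = set0) ?inf0//.
apply/seteqP; split => // x [_]; apply/negP; rewrite -leNgt.
by apply: le_trans (distrf_ge0 x); rewrite lee_fin.
Qed.

Lemma rearr_nonincreasing (u v : R) : 0 < u -> u <= v -> rz v <= rz u.
Proof.
move=> u0 uv; apply: lb_le_inf.
  by have [x x0 nx] := distrf_lt_infty _ u0; exists x.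
move=> x [x0 nx]; apply: ge_inf; first by exists 0 => y [/ltW].
by split => //; apply: lt_le_trans nx _; rewrite lee_fin.
Qed.

(** Right-continuity leaves room for some [tau' > tau] with [u < n tau']; it bounds the defining set
    from below, which makes the conclusion strict. *)
Lemma rearr_gt (u tau : R) : 0 < u -> 0 <= tau -> (u%:E < n tau)%E -> tau < rz u.
Proof.
move=> u0 tau0 /distrf_gt_right[tau' tt' nu]; apply: lt_le_trans tt' _.
apply: lb_le_inf.
  by have [x x0 nx] := distrf_lt_infty _ u0; exists x.
move=> x [x0 nx]; rewrite leNgt; apply/negP => /ltW /distrf_nonincreasing nn.
by have := lt_le_trans (lt_trans nx nu) nn; rewrite ltxx.
Qed.

(** Otherwise [tau] would itself belong to the defining set. The case [u = n tau] remains
    undecided. *)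
Lemma rearr_gt_distrf (u tau : R) : 0 < tau -> tau < rz u -> (u%:E <= n tau)%E.
Proof.
move=> tau0 tr; rewrite leNgt; apply/negP => nu.
have : rz u <= tau by apply: ge_inf; [exists 0 => y [/ltW] | split].
by rewrite leNgt tr.
Qed.

Lemma rearr_superlevel_itv (tau : R) : 0 <= tau ->
  is_interval [set u | unitI R u /\ tau < rz u].
Proof.
move=> tau0 u v [Iu ru] [Iv rv] w /andP[uw wv]; split.
  move: Iu Iv; rewrite /unitI/= !in_itv/= => /andP[u0 _] /andP[_ v1].
  by rewrite (le_trans u0 uw) (le_trans wv v1).
(* The default value [0] breaks monotonicity at the origin, so [u = 0] must be excluded first. *)
have u0 : 0 < u by rewrite ltNge; apply/negP => /rearr_le0 r0;
  move: ru; rewrite r0 ltNge tau0.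
by apply: lt_le_trans rv _; apply: rearr_nonincreasing => //; exact: lt_le_trans uw.
Qed.

(** It suffices to test open upper rays: levels [x >= 0] give intervals, and negative levels give
    all of [I]. *)
Lemma measurable_rearr : measurable_fun (unitI R) rz.
Proof.
move=> mI; apply: (measurability _ (RGenOInfty.measurableE R)) => //.
move=> _ [_ [x ->] <-].
have [x0|x0] := leP 0 x.
  rewrite [X in measurable X](_ : _ = [set u | unitI R u /\ x < rz u]).
    by apply: is_interval_measurable; exact: rearr_superlevel_itv.
  by apply/seteqP; split => u [Iu] /=; rewrite in_itv/= andbT.
rewrite [X in measurable X](_ : _ = unitI R)//.
apply/seteqP; split => [u []//|u Iu]; split => //=.
by rewrite in_itv/= andbT (lt_le_trans x0)// rearr_ge0.
Qed.

(* Up to one endpoint, the superlevel set of the rearrangement is the interval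
   ]0, n tau[. *)
Lemma distrf_rearr (tau : R) : 0 < tau ->
  distrf (@lebesgue_measure R) (unitI R) rz tau = n tau.
Proof.
move=> tau0.
have n0 : 0 <= fine (n tau) by rewrite fine_ge0// distrf_ge0.
have nE : n tau = (fine (n tau))%:E by rewrite fineK// distrf_fin_num.
have n1 : fine (n tau) <= 1 by rewrite -lee_fin -nE distrf_le1.
(* The boolean selects the right endpoint: [false] includes it, for the upper bound, and [true]
   excludes it, for the lower bound. *)
have leb (b : bool) : lebesgue_measure
    ([set` Interval (BRight 0) (BSide b (fine (n tau)))] : set R) = n tau.
  rewrite lebesgue_measure_itv/= lte_fin [RHS]nE.
  by case: ltgtP n0 => // [n0 _|<- _]; rewrite ?sube0.
rewrite /distrf (_ : _ `&` _ = [set u | unitI R u /\ tau < rz u]); last first.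
  by apply/seteqP; split => u [Iu] /=; rewrite ger0_norm ?rearr_ge0.
have mS := is_interval_measurable (rearr_superlevel_itv _ (ltW tau0)).
apply/eqP; rewrite eq_le; apply/andP; split.
- rewrite -(leb false); apply: le_measure; rewrite ?inE//.
  move=> u [Iu ru] /=; rewrite in_itv/=; apply/andP; split.
    by rewrite ltNge; apply/negP => /rearr_le0 r0; move: ru; rewrite r0 ltNge ltW.
  by rewrite -lee_fin -nE; exact: rearr_gt_distrf.
- rewrite -(leb true); apply: le_measure; rewrite ?inE//.
  move=> u /=; rewrite in_itv/= => /andP[u0 un]; split.
    by rewrite /unitI/= in_itv/= (ltW u0) (le_trans (ltW un)).
  by apply: rearr_gt => //; [exact: ltW | rewrite nE lte_fin].
Qed.

End rearrangement.

(** * Scaling of Lebesgue measure; measures of the unit interval and square *)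

Lemma lebesgue_measure_scale {R : realType} (t : R) (A : set R) : 0 < t ->
  measurable A ->
  (@lebesgue_measure R [set u | A (u / t)%R] = t%:E * lebesgue_measure A)%E.
Proof.
move=> t0 mA.
pose f (u : R) : measurableTypeR R := u / t.
have mf : measurable_fun [set: R] f by exact: mulrr_measurable.
have ti0 : 0 <= t^-1 by rewrite invr_ge0 ltW.
pose ti : {nonneg R} := NngNum ti0.
pose fm : {measure set (measurableTypeR R) -> \bar R} :=
  pushforward (@lebesgue_measure R) f.
(* By uniqueness, it is enough that [1/t] times the image of Lebesgue measure under division by [t]
   gives half-open intervals their length. *)
rewrite (@lebesgue_measure_unique _ (mscale ti (fm mf)) _ A)//.
  by rewrite /= /mscale muleA -EFinM/= divff ?gt_eqF// mul1e.
move=> _ [[a b] _ <-] /=.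
rewrite /mscale /=.
have fE : f @^-1` `]a, b] = `]a * t, b * t]%classic.
  by apply/seteqP; split => u /=; rewrite !in_itv/= /f ltr_pdivlMr// ler_pdivrMr.
rewrite /fm /pushforward -/f fE.
rewrite !lebesgue_measure_itv/= !lte_fin ltr_pM2r//.
case: ifP => _; last by rewrite mule0.
by rewrite -!EFinB -EFinM -mulrBl mulrC mulfK// gt_eqF.
Qed.

Lemma measurable_unitI {R : realType} : measurable (unitI R).
Proof. exact: measurable_itv. Qed.

Lemma lebesgue_measure_unitI {R : realType} : @lebesgue_measure R (unitI R) = 1%E.
Proof. by rewrite lebesgue_measure_itv/= lte_fin ltr01 sube0. Qed.

Lemma lebesgue_measure_unitI_le1 {R : realType} :
  (@lebesgue_measure R (unitI R) <= 1)%E.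
Proof. by rewrite lebesgue_measure_unitI. Qed.

Lemma leb2_unitII_le1 {R : realType} : (@leb2 R (unitII R) <= 1)%E.
Proof.
have mI := @measurable_unitI R.
rewrite /leb2 /unitII product_measure1E//=.
by rewrite !(lebesgue_measure_unitI : lebesgue_measure _ = _) mule1.
Qed.

(** * Distribution functions of the dilation and of the tensor product *)

Section dilation.
Context {R : realType} (t : R).
Hypotheses (t_gt0 : 0 < t) (t_le1 : t <= 1).
Variable y : R -> R.
Hypothesis my : measurable_fun (unitI R) y.

Lemma measurable_dilation : measurable_fun (unitI R) (dilation t y).
Proof.
have -> : dilation t y = (y \_ (unitI R)) \o (fun u : R => u / t).
  by apply/funext => u; rewrite /dilation /= patch_indic.
apply: measurable_funTS; apply: measurableT_comp.
  by apply/(measurable_restrictT _ measurable_unitI).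
exact: mulrr_measurable.
Qed.

(** The superlevel set of the dilation is [t] times that of [y]; since [t <= 1], none of it falls
    outside [I]. *)
Lemma distrf_dilation (tau : R) : 0 < tau ->
  distrf (@lebesgue_measure R) (unitI R) (dilation t y) tau =
  (t%:E * distrf (@lebesgue_measure R) (unitI R) y tau)%E.
Proof.
move=> tau0; rewrite /distrf -lebesgue_measure_scale//; last first.
  exact: measurable_superlevel measurable_unitI my _.
congr (lebesgue_measure _); apply/seteqP; split => u [Iu /=]; rewrite /dilation indicE.
  have [/set_mem Iut|_] := boolP (u / t \in unitI R).
    by rewrite mulr1; split.
  by rewrite mulr0 normr0 ltNge (ltW tau0).
move=> ytau; split; last by rewrite mem_set//= mulr1.
move: Iu; rewrite /unitI /= !in_itv/= ler_pdivrMr// mul1r.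
by rewrite pmulr_lge0 ?invr_gt0// => /andP[-> /le_trans]; exact.
Qed.

Lemma measurable_tensor_indic :
  measurable_fun (unitII R) (tensorf (\1_(`]0, t[ : set R)) y).
Proof.
rewrite /tensorf; apply: measurable_funM.
  have m1 : measurable_fun [set: R] (\1_(`]0, t[ : set R) : R -> R).
    by apply: measurable_indic; exact: measurable_itv.
  have m2 : measurable_fun (unitII R) (@fst R R).
    exact: measurable_funTS measurable_fst.
  by have := measurableT_comp m1 m2.
apply: (measurable_comp (F := unitI R)) => //.
- exact: measurable_unitI.
- by move=> _ [p [_ Ip] <-].
- exact: measurable_funTS measurable_snd.
Qed.

(** The superlevel set is the rectangle with sides []0, t[] and the superlevel set of [y]. *)
Lemma distrf_tensor_indic (tau : R) : 0 < tau ->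
  distrf (@leb2 R) (unitII R) (tensorf (\1_(`]0, t[ : set R)) y) tau =
  (t%:E * distrf (@lebesgue_measure R) (unitI R) y tau)%E.
Proof.
move=> tau0.
have -> : t%:E = @lebesgue_measure R `]0, t[%classic.
  by rewrite lebesgue_measure_itv/= lte_fin t_gt0 sube0.
rewrite /distrf -product_measure1E//; last first.
  exact: measurable_superlevel measurable_unitI my _.
congr (leb2 _); apply/seteqP; split => -[s v] /=.
  rewrite /tensorf /= indicE => -[[_ Iv]].
  have [/set_mem st|_] := boolP (s \in _).
    by rewrite mul1r.
  by rewrite mul0r normr0 ltNge (ltW tau0).
rewrite in_itv/= => -[st [Iv yv]]; split.
  split => //; move: st => /andP[/ltW s0 /ltW st].
  by rewrite /unitI/= in_itv/= s0 (le_trans st).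
by rewrite /tensorf /= indicE mem_set//= ?in_itv// mul1r.
Qed.

End dilation.

(** * Comparison of norms in a symmetric space *)

Section symmetric_space_dilation.
Context {R : realType} (E : symmetric_space R).

Lemma equimeasurable_sym (x y : R -> R) : equimeasurable x y -> equimeasurable y x.
Proof. by move=> xy tau tau0; rewrite xy. Qed.

Lemma equimeasurable_rearr (x : R -> R) : measurable_fun (unitI R) x ->
  equimeasurable (rearr (@lebesgue_measure R) (unitI R) x) x.
Proof.
move=> mx tau.
exact: (distrf_rearr (@lebesgue_measure R) _ _ measurable_unitI mx lebesgue_measure_unitI_le1).
Qed.

(* Domination of distribution functions passes to the rearrangements, to which
   the ideal property applies pointwise. *)
Lemma ss_distrf_le (x y : R -> R) : measurable_fun (unitI R) x -> ss_car E y ->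
  (forall tau, 0 < tau -> (distrf (@lebesgue_measure R) (unitI R) x tau <=
                           distrf (@lebesgue_measure R) (unitI R) y tau)%E) ->
  ss_car E x /\ ss_norm E x <= ss_norm E y.
Proof.
move=> mx Ey xy; have my := ss_meas Ey.
have mI := @measurable_unitI R.
have I1 := @lebesgue_measure_unitI_le1 R.
have [Ery <-] := ss_symm (measurable_rearr (@lebesgue_measure R) _ _ mI my I1) Ey
  (equimeasurable_rearr _ my).
have [|Erx le_xy] := ss_ideal (measurable_rearr (@lebesgue_measure R) _ _ mI mx I1) Ery.
  apply: aeW => u Iu; rewrite !ger0_norm ?rearr_ge0//.
  (* The point [0] belongs to [I]; there both rearrangements take the default value [0]. *)
  have [u0|u0] := leP u 0; first by rewrite !rearr_le0.
  apply: lb_le_inf.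
    by have [a a0 na] := distrf_lt_infty (@lebesgue_measure R) _ _ mI my I1 _ u0;
      exists a.
  move=> a [a0 na]; apply: ge_inf; first by exists 0 => b [/ltW].
  by split => //; apply: le_lt_trans na; exact: xy.
have [Ex xE] := ss_symm mx Erx (equimeasurable_sym _ _ (equimeasurable_rearr _ mx)).
by rewrite xE.
Qed.

Lemma ss_dilation (t : R) (y : R -> R) : 0 < t -> t <= 1 -> ss_car E y ->
  ss_car E (dilation t y) /\ ss_norm E (dilation t y) <= ss_norm E y.
Proof.
move=> t0 t1 Ey; have my := ss_meas Ey.
apply: ss_distrf_le => // [|tau tau0]; first exact: measurable_dilation.
by rewrite distrf_dilation// gee_pMl ?distrf_ge0// ?lee_fin ?(ltW t0)//;
  apply: distrf_fin_num => //; rewrite ?lebesgue_measure_unitI.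
Qed.

Lemma ss2_tensor_indic (t : R) (y : R -> R) : 0 < t -> t <= 1 -> ss_car E y ->
  let z := tensorf (\1_(`]0, t[ : set R)) y in
  ss2_car E z /\ ss2_norm E z = ss_norm E (dilation t y).
Proof.
move=> t0 t1 Ey z; have my := ss_meas Ey.
have mz : measurable_fun (unitII R) z by exact: measurable_tensor_indic.
have mII : measurable (unitII R) by apply: measurableX; exact: measurable_unitI.
have II1 := @leb2_unitII_le1 R.
pose mu2 := (@lebesgue_measure R \x @lebesgue_measure R)%E.
have [|//] := ss_symm (measurable_rearr mu2 _ _ mII mz II1)
  (ss_dilation _ _ t0 t1 Ey).1.
by move=> tau tau0; rewrite (distrf_rearr mu2 _ _ mII mz II1)// distrf_dilation//
  -distrf_tensor_indic.
Qed.

(** This puts a point in the unit ball, so that suprema over it are not [-oo]. *)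
Lemma ss_zero : ss_car E (fun _ => 0) /\ ss_norm E (fun _ => 0) = 0.
Proof.
have [x [Ex _]] := ss_nonzero E.
have x0 : (fun s => 0 * x s) = fun _ => 0 by apply/funext => s; rewrite mul0r.
by split; rewrite -x0; [exact: ss_scale | rewrite ss_normZ// normr0 mul0r].
Qed.

End symmetric_space_dilation.

Theorem mainTheorem1 (R : realType) (E : symmetric_space R) (t : R)
    (t_gt0 : 0 < t) (t_le1 : t <= 1) :
  [/\ mult_car E (\1_(`]0, t[ : set R)),
      (forall y : R -> R, ss_car E y -> ss_car E (dilation t y)),
      ss_opnorm E (dilation t) \is a fin_num
    & mult_fundamental E t = ss_opnorm E (dilation t)].
Proof.
split.
- split; first exact: measurable_indic.
  by move=> y Ey; have [] := ss2_tensor_indic _ _ _ t_gt0 t_le1 Ey.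
- by move=> y Ey; have [] := ss_dilation _ _ _ t_gt0 t_le1 Ey.
- rewrite fin_numElt; apply/andP; split.
    have [E0 N0] := ss_zero E.
    apply: (@lt_le_trans _ _ (ss_norm E (dilation t (fun _ => 0)))%:E).
      by rewrite ltNyr.
    by apply: ereal_sup_ubound; exists (fun _ => 0) => //; split; rewrite ?N0.
  (* The dilation is a contraction, so [1] bounds the supremum. *)
  apply: (@le_lt_trans _ _ 1%E); last exact: ltry.
  apply: ub_ereal_sup => _ [y [Ey y1] <-].
  by rewrite lee_fin (le_trans (ss_dilation _ _ _ t_gt0 t_le1 Ey).2).
(* The two norms agree for each [y] separately, so the sets of values coincide. *)
- congr ereal_sup; apply: eq_imagel => y [Ey _]; congr EFin.
  by have [] := ss2_tensor_indic _ _ _ t_gt0 t_le1 Ey.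
Qed.
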